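(* Let $(m,n)$ be a coprime pair of positive integers. An SW-sequence $\sigma=(\sigma_1,\dots,\sigma_{m+n})$ is equal to $\sigma(D)$ for some $(m,n)$-Dyck path $D$ if and only if there is a nonnegative rank set $R$ compatible with $\sigma$.
   Context: An $(m,n)$-Dyck path $D$ is a lattice path $P_0=(0,0),\dots,P_{m+n}=(m,n)$ with steps $u=(0,1)$ and $d=(1,0)$ that never goes below $y=\frac nm x$. The rank of $(a,b)$ is $mb-na$. The rank set of $D$ is $R(D)=\{\text{ranks of }P_0,\dots,P_{m+n-1}\}$, consisting of $m+n$ distinct nonnegative integers. $S(D)$ and $W(D)$ are the sets of ranks of starting points of $u$ steps (south ends) and of $d$ steps (west ends) of $D$, respectively; $R(D)=S(D)\uplus W(D)$. Let $\mathfrak r_1<\dots<\mathfrak r_{m+n}$ be the increasing rearrangement of $R(D)$. The SW-sequence of $D$ is $\sigma(D)=(\sigma_1,\dots,\sigma_{m+n})$ with $\sigma_i=S$ if $\mathfrak r_i\in S(D)$ and $\sigma_i=W$ if $\mathfrak r_i\in W(D)$. In general, an SW-sequence is a word of length $m+n$ with $n$ letters $S$ and $m$ letters $W$. From left to right the $i$-th $S$ is labelled $S_i$ and the $j$-th $W$ is labelled $W_j$; $\sigma^{-1}(S_i)$ and $\sigma^{-1}(W_j)$ are their positions. A nonnegative rank set here means a set $R$ of $m+n$ distinct nonnegative integers with $0\in R$; for such $R$ with increasing rearrangement $\mathfrak r=(\mathfrak r_1,\dots,\mathfrak r_{m+n})$ put $\mathfrak r(S_i)=\mathfrak r_{\sigma^{-1}(S_i)}$,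 $\mathfrak r(W_j)=\mathfrak r_{\sigma^{-1}(W_j)}$. $R$ is compatible with $\sigma$ if $\mathfrak r(S_i)+m\in R$ for all $1\le i\le n$ and $\mathfrak r(W_j)-n\in R$ for all $1\le j\le m$. *)

(* Defs.v *)
From HB Require Import structures.
From mathcomp Require Import all_boot all_order all_algebra.
From mathcomp Require Import finmap zify.

Set Implicit Arguments.
Unset Strict Implicit.
Unset Printing Implicit Defensive.

Import Order.TTheory GRing.Theory Num.Theory.
Local Open Scope fset_scope.
Local Open Scope ring_scope.

(* Ustep is u = (0,1), Dstep is d = (1,0). *)
Inductive step : Type := Ustep | Dstep.

Definition is_Ustep (s : step) : bool := if s is Ustep then true else false.
Lemma is_UstepK : cancel is_Ustep (fun b => if b then Ustep else Dstep).
Proof. by case. Qed.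
HB.instance Definition _ := Equality.copy step (can_type is_UstepK).

Inductive letter : Type := South | West.

Definition is_South (l : letter) : bool := if l is South then true else false.
Lemma is_SouthK : cancel is_South (fun b => if b then South else West).
Proof. by case. Qed.
HB.instance Definition _ := Equality.copy letter (can_type is_SouthK).

Section Paths.
Variables m n : nat.
Implicit Type D : (m + n).-tuple step.

(* The lattice point P_k = (a, b). *)
Definition point D (k : nat) : nat * nat :=
  (count_mem Dstep (take k D), count_mem Ustep (take k D)).

(* Steps are axis-parallel, so a path stays weakly above the line as soon as
   its lattice points do. *)
Definition dyck_path D : Prop :=
  point D (m + n) = (m, n) /\
  forall k : nat, (k <= m + n)%N ->
    (n%:R / m%:R) * (point D k).1%:R <= (point D k).2%:R :> rat.

Definition rank (p : nat * nat) : int :=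
  m%:Z * p.2%:Z - n%:Z * p.1%:Z.

Definition rank_set D : {fset int} :=
  [fset rank (point D (nat_of_ord k)) | k in 'I_(m + n)].

Definition south_ranks D : {fset int} :=
  [fset rank (point D (nat_of_ord k)) | k in 'I_(m + n) & tnth D k == Ustep].

Definition west_ranks D : {fset int} :=
  [fset rank (point D (nat_of_ord k)) | k in 'I_(m + n) & tnth D k == Dstep].

Definition increasing (R : {fset int}) : seq int := sort <=%R (enum_fset R).

(* The else branch is the case of a west rank: see rank_setE and
   disjoint_south_west below. *)
Definition SW_of_path D : seq letter :=
  [seq if r \in south_ranks D then South else West
     | r <- increasing (rank_set D)].

Definition SW_sequence (sigma : seq letter) : Prop :=
  [/\ size sigma = (m + n)%N,
      count_mem South sigma = n &
      count_mem West sigma = m].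

(* Positions and labels are 0-based: position sigma South i is the position of
   the (i+1)-st South. *)
Definition position (sigma : seq letter) (l : letter) (i : nat) : nat :=
  nth (size sigma)
      [seq k <- iota 0 (size sigma) | nth South sigma k == l] i.

Definition rank_at (R : {fset int}) (sigma : seq letter) (l : letter)
    (i : nat) : int :=
  nth 0 (increasing R) (position sigma l i).

Definition nonneg_rank_set (R : {fset int}) : Prop :=
  [/\ #|` R| = (m + n)%N, (forall r, r \in R -> 0 <= r) & 0 \in R].

Definition compatible (R : {fset int}) (sigma : seq letter) : Prop :=
  (forall i : nat, (i < n)%N -> rank_at R sigma South i + m%:Z \in R) /\
  (forall j : nat, (j < m)%N -> rank_at R sigma West j - n%:Z \in R).

Lemma rank_setE D : rank_set D = south_ranks D `|` west_ranks D.
Proof.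
apply/fsetP => r; rewrite in_fsetU; apply/imfsetP/orP => /= [[k _ ->]|].
  by case Dk: (tnth D k); [left | right]; apply/imfsetP; exists k;
     rewrite //= inE Dk.
by case=> /imfsetP[k _ ->]; exists k.
Qed.

Lemma rank_point_inj D (k l : nat) : (0 < m)%N -> coprime m n ->
  (k < m + n)%N -> (l < m + n)%N ->
  rank (point D k) = rank (point D l) -> k = l.
Proof.
move=> m_gt0 co_mn; wlog le_kl: k l / (k <= l)%N => [IH|] lt_k lt_l.
  by case/orP: (leq_total k l) => le eqr; [|symmetry];
     apply: IH.
have sum_pt j : (j < m + n)%N -> ((point D j).1 + (point D j).2)%N = j.
  move=> lt_j; have size_j : size (take j D) = j.
    by rewrite size_takel // size_tuple ltnW.
  rewrite -[RHS]size_j -(count_predC (pred1 Dstep)); congr (_ + _)%N.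
  by apply: eq_count => -[].
have := sum_pt k lt_k; have := sum_pt l lt_l; rewrite /rank.
have le1 : ((point D k).1 <= (point D l).1)%N.
  by apply: leq_count_subseq; rewrite -(take_takel D le_kl) take_subseq.
have le2 : ((point D k).2 <= (point D l).2)%N.
  by apply: leq_count_subseq; rewrite -(take_takel D le_kl) take_subseq.
move: (point D k) (point D l) le1 le2 => [a b] [a' b'] /= le1 le2 el ek eqr.
have eqn : (m * (b' - b) = n * (a' - a))%N by nia.
have dvd_m : (m %| a' - a)%N by rewrite -(Gauss_dvdr _ co_mn) -eqn dvdn_mulr.
case/dvdnP: dvd_m => q eq_q.
have eq_b : (b' - b = n * q)%N.
  by apply/eqP; rewrite -(eqn_pmul2l m_gt0) eqn eq_q mulnA mulnAC -mulnA; lia.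
by case: q eq_q eq_b => [|q]; nia.
Qed.

Lemma disjoint_south_west D : (0 < m)%N -> coprime m n ->
  [disjoint south_ranks D & west_ranks D].
Proof.
move=> m_gt0 co_mn; apply/fdisjointP => r /imfsetP[k /= Dk ->].
apply/imfsetP => -[l /= Dl]; move/(rank_point_inj m_gt0 co_mn) => eq_kl.
have {}eq_kl : k = l by apply/val_inj/eq_kl.
by move: Dk Dl; rewrite !inE eq_kl => /eqP ->.
Qed.

End Paths.

(* Main.v *)
(* The map sending a rank [r] of a compatible [R] to [r + m] if its letter is
   South and to [r - n] if it is West stabilises [R].  Since [m = - n] modulo
   [m + n], its k-th iterate at 0 is congruent to [k * m], and [m] is coprime
   to [m + n]; hence the first [m + n] iterates are distinct, exhaust [R], and
   the next one is 0 again.  The letters met along this cycle are the steps of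
   the Dyck path. *)
Require Import Defs.
From mathcomp Require Import all_boot all_order all_algebra.
From mathcomp Require Import finmap.
From mathcomp Require Import zify.

Set Implicit Arguments.
Unset Strict Implicit.
Unset Printing Implicit Defensive.

Import Order.TTheory GRing.Theory Num.Theory.
Local Open Scope fset_scope.
Local Open Scope ring_scope.

(** The change of rank caused by one step or one letter. Taking a boolean lets steps of a path and
    letters of a word share it. *)
Definition shift (m n : nat) (up : bool) : int := if up then m%:Z else - n%:Z.

(** The letter of [r] is read at its index in the sorted set. Outside [R] this letter is
    meaningless, but [next_rank_in] keeps the orbit of 0 inside [R]. *)
Definition next_rank (m n : nat) (R : {fset int}) (sigma : seq letter)
    (r : int) : int :=
  r + shift m n (nth South sigma (index r (increasing R)) == South).

Definition path_of (m n : nat) (R : {fset int}) (sigma : seq letter) :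
    (m + n).-tuple step :=
  [tuple if nth South sigma
             (index (iter k (next_rank m n R sigma) 0) (increasing R)) == South
         then Ustep else Dstep | k < m + n].

(** * Sorted rank sets and positions of letters *)

Lemma mem_increasing (R : {fset int}) : increasing R =i R.
Proof. by move=> r; rewrite mem_sort. Qed.

Lemma size_increasing (R : {fset int}) : size (increasing R) = #|` R|.
Proof. by rewrite size_sort. Qed.

Lemma uniq_increasing (R : {fset int}) : uniq (increasing R).
Proof. by rewrite sort_uniq fset_uniq. Qed.

Lemma size_positions (sigma : seq letter) (l : letter) :
  size [seq k <- iota 0 (size sigma) | nth South sigma k == l]
    = count_mem l sigma.
Proof.
rewrite size_filter -[in RHS](mkseq_nth South sigma) /mkseq count_map.
by apply: eq_count.
Qed.

Lemma position_prop (sigma : seq letter) (l : letter) (i : nat) :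
  (i < count_mem l sigma)%N ->
  (position sigma l i < size sigma)%N /\
  nth South sigma (position sigma l i) = l.
Proof.
rewrite -size_positions => /(mem_nth (size sigma)).
by rewrite mem_filter mem_iota => /andP[/eqP-> /andP[_ ->]].
Qed.

Lemma position_surj (sigma : seq letter) (k : nat) : (k < size sigma)%N ->
  exists2 i, (i < count_mem (nth South sigma k) sigma)%N &
    position sigma (nth South sigma k) i = k.
Proof.
move=> ltk; set l := nth South sigma k.
have kin : k \in [seq k <- iota 0 (size sigma) | nth South sigma k == l].
  by rewrite mem_filter eqxx mem_iota.
by exists (index k [seq k <- iota 0 (size sigma) | nth South sigma k == l]);
   [rewrite -size_positions index_mem | exact: nth_index].
Qed.

(** Every position carries a label and every label has a position, so the two conditions indexed by
    labels merge into one indexed by positions. *)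
Lemma compatibleE (m n : nat) (R : {fset int}) (sigma : seq letter) :
  SW_sequence m n sigma ->
  compatible m n R sigma <->
  forall k, (k < m + n)%N ->
    nth 0 (increasing R) k + shift m n (nth South sigma k == South) \in R.
Proof.
case=> size_sigma nS nW; rewrite -size_sigma; split=> [[cS cW] k|cR].
  case/position_surj=> i; case: (nth South sigma k) => lt_i <-.
    by apply: cS; rewrite -nS.
  by apply: cW; rewrite -nW.
by split=> i; rewrite -?[in (_ < n)%N]nS -?[in (_ < m)%N]nW;
   move=> /position_prop[/cR + eql]; rewrite eql.
Qed.

(** * Ranks along an arbitrary sequence of steps *)

Section Paths.
Variables (m n : nat) (D : (m + n).-tuple step).

Lemma point0 : point D 0 = (0, 0)%N.
Proof. by rewrite /point take0. Qed.

Lemma point_sum k : (k <= m + n)%N -> ((point D k).1 + (point D k).2)%N = k.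
Proof.
move=> le_k; have size_k : size (take k D) = k.
  by rewrite size_takel // size_tuple.
rewrite -[RHS]size_k -(count_predC (pred1 Dstep)); congr (_ + _)%N.
by apply: eq_count => -[].
Qed.

Lemma rank_pointS (k : 'I_(m + n)) :
  rank m n (point D k.+1)
    = rank m n (point D k) + shift m n (tnth D k == Ustep).
Proof.
rewrite /rank /point (take_nth Ustep) ?size_tuple //.
rewrite -!cats1 !count_cat (tnth_nth Ustep) /shift.
by case: (nth Ustep D k) => /=; lia.
Qed.

(** Eliminating the height by [point_sum] exhibits the rank as [m * k] modulo [m + n]. *)
Lemma rank_pointE k : (k <= m + n)%N ->
  rank m n (point D k) = m%:Z * k%:Z - (m + n)%:Z * (point D k).1%:Z.
Proof. by move=> /point_sum; rewrite /rank; lia. Qed.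

Lemma rank_ge0 (p : nat * nat) : (0 < m)%N ->
  (n%:R / m%:R * p.1%:R <= p.2%:R :> rat) = (0 <= rank m n p).
Proof.
move=> m_gt0; rewrite mulrAC ler_pdivrMr ?ltr0n // -!natrM ler_nat /rank.
by apply/idP/idP; lia.
Qed.

Hypotheses (m_gt0 : (0 < m)%N) (co_mn : coprime m n).

Lemma mem_south_ranks (k : 'I_(m + n)) :
  (rank m n (point D k) \in south_ranks D) = (tnth D k == Ustep).
Proof.
apply/imfsetP/idP => [[l /= Dl]|Dk]; last by exists k.
move/(rank_point_inj m_gt0 co_mn) => eq_kl.
by rewrite (val_inj (eq_kl _ _)) //; move: Dl; rewrite inE.
Qed.

Lemma card_rank_set : #|` rank_set D| = (m + n)%N.
Proof.
rewrite card_imfset /=; first by rewrite -cardE card_ord.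
by move=> k l /(rank_point_inj m_gt0 co_mn) eq_kl; apply/val_inj/eq_kl.
Qed.

(** If the final rank repeats that of an earlier point [k], then [m + n] divides [m * k], hence [k]
    by coprimality, so [k = 0]. *)
Lemma rank_point_last : rank m n (point D (m + n)) \in rank_set D ->
  point D (m + n) = (m, n).
Proof.
case/imfsetP=> k _ /=; have lt_k := ltn_ord k.
have := point_sum (leqnn (m + n)); have := rank_pointE (leqnn (m + n)).
case: (point D (m + n)) => a b /= -> sum_ab eqr.
have dvd_k : (m + n %| k)%N.
  have co : coprime (m + n) m by rewrite /coprime gcdnC gcdnDl.
  rewrite -(Gauss_dvdr _ co).
  suff: (Posz (m + n) %| Posz (m * k))%Z by [].
  move: eqr; rewrite rank_pointE ?(ltnW lt_k) // => eqr.
  (* The quotient comes from equating the forms given by [rank_pointE] at [m + n] and at [k]. *)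
  by apply/dvdzP; exists (m%:Z + (point D k).1%:Z - a%:Z); nia.
have k0 : k = 0%N :> nat.
  by case: (posnP k) => // /dvdn_leq/(_ dvd_k); rewrite leqNgt lt_k.
(* The final rank is thus 0, so [(m + n) * a = (m + n) * m]. *)
move: eqr; rewrite k0 point0 /rank /= => eqr.
have eq_am : a = m.
  apply/eqP; rewrite -(@eqn_pmul2l (m + n)) ?addn_gt0 ?m_gt0 //; apply/eqP.
  by rewrite [RHS]mulnC; nia.
by congr pair; lia.
Qed.

Lemma dyck_rank_set_ge0 : dyck_path D -> forall r, r \in rank_set D -> 0 <= r.
Proof.
case=> _ geD r /imfsetP[k /= _ ->].
by rewrite -rank_ge0 //; apply/geD/ltnW/ltn_ord.
Qed.

Lemma mem_rank_set k : (k < m + n)%N -> rank m n (point D k) \in rank_set D.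
Proof. by move=> lt_k; apply/imfsetP; exists (Ordinal lt_k). Qed.

Lemma rank_set0 : 0 \in rank_set D.
Proof.
have -> : 0 = rank m n (point D 0) by rewrite point0 /rank !mulr0 subrr.
by apply: mem_rank_set; lia.
Qed.

(** The shift follows the step leaving the point of rank [r]. After the last step it reaches
    [(m, n)], whose rank 0 is that of the origin, so the ranks close up into a cycle. *)
Lemma rank_set_shift r : dyck_path D -> r \in rank_set D ->
  r + shift m n (r \in south_ranks D) \in rank_set D.
Proof.
case=> last_pt _ /imfsetP[k /= _ ->].
rewrite mem_south_ranks -rank_pointS.
have := ltn_ord k; rewrite leq_eqVlt => /orP[/eqP->|]; last exact: mem_rank_set.
by rewrite last_pt /rank /= mulrC subrr rank_set0.
Qed.

End Paths.

(** * The path traced by a compatible rank set *)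

Section Cycle.
Variables (m n : nat) (R : {fset int}) (sigma : seq letter).
Hypotheses (m_gt0 : (0 < m)%N) (co_mn : coprime m n).
Hypotheses (sigma_SW : SW_sequence m n sigma).
Hypotheses (R_rank : nonneg_rank_set m n R) (cR : compatible m n R sigma).

Let D := path_of m n R sigma.

Lemma next_rank_in r : r \in R -> next_rank m n R sigma r \in R.
Proof.
case: R_rank => cardR _ _; rewrite -mem_increasing => rR.
have := (compatibleE R sigma_SW).1 cR (index r (increasing R)).
by rewrite -cardR -size_increasing index_mem nth_index // => /(_ rR).
Qed.

Lemma tnth_path_of (k : 'I_(m + n)) :
  (tnth D k == Ustep) =
  (nth South sigma
     (index (iter k (next_rank m n R sigma) 0) (increasing R)) == South).
Proof. by rewrite tnth_mktuple; case: ifP. Qed.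

Lemma rank_path_of k : (k <= m + n)%N ->
  rank m n (point D k) = iter k (next_rank m n R sigma) 0.
Proof.
elim: k => [_|k IHk lt_k]; first by rewrite point0 /rank !mulr0 subrr.
rewrite (rank_pointS D (Ordinal lt_k)) /= (IHk (ltnW lt_k)) tnth_path_of.
by [].
Qed.

(** The endpoint [k = m + n] is included: its rank lying in [R] is what lets [rank_point_last] close
    the path. *)
Lemma rank_path_of_in k : (k <= m + n)%N -> rank m n (point D k) \in R.
Proof.
move=> le_k; rewrite rank_path_of //; elim: k {le_k} => [|k IHk] /=.
  by case: R_rank.
exact: next_rank_in.
Qed.

(** Ranks are distinct along any sequence of steps, Dyck or not, so the inclusion in [R] is an
    equality by cardinality. *)
Lemma rank_set_path_of : rank_set D = R.
Proof.
apply/eqP; rewrite eqEfcard card_rank_set //; case: (R_rank) => -> _ _.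
rewrite leqnn andbT; apply/fsubsetP => r /imfsetP[k /= _ ->].
exact/rank_path_of_in/ltnW.
Qed.

Lemma dyck_path_of : dyck_path D.
Proof.
split=> [|k le_k]; first by apply: rank_point_last;
    rewrite // rank_set_path_of rank_path_of_in.
by rewrite rank_ge0 //; case: R_rank => _ + _; apply; apply: rank_path_of_in.
Qed.

Lemma SW_of_path_of : SW_of_path D = sigma.
Proof.
case: (R_rank) (sigma_SW) => cardR _ _ [size_sigma _ _].
rewrite /SW_of_path rank_set_path_of.
apply: (@eq_from_nth _ South) => [|k];
  rewrite size_map size_increasing cardR ?size_sigma //.
move=> lt_k; rewrite (nth_map 0) ?size_increasing ?cardR //.
set r := nth _ _ _; have rR : r \in rank_set D.
  by rewrite rank_set_path_of -mem_increasing /r mem_nth ?size_increasing ?cardR.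
have idx : index r (increasing R) = k.
  by rewrite index_uniq ?uniq_increasing ?size_increasing ?cardR.
(* Now [r] is the rank of point [j], and step [j] was chosen from the letter of [sigma] at the index
   of [r], which is [k]. *)
case/imfsetP: rR => j /= _ eqr; rewrite {1}eqr mem_south_ranks //.
rewrite tnth_path_of -rank_path_of ?(ltnW (ltn_ord j)) // -eqr idx.
by case: (nth South sigma k).
Qed.

End Cycle.

Theorem theorem8 (m n : nat) (m_gt0 : (0 < m)%N) (n_gt0 : (0 < n)%N)
    (co_mn : coprime m n) (sigma : seq letter)
    (sigma_SW : SW_sequence m n sigma) :
  (exists D : (m + n).-tuple step, dyck_path D /\ SW_of_path D = sigma) <->
  (exists R : {fset int}, nonneg_rank_set m n R /\ compatible m n R sigma).
Proof.
split=> [[D [dyckD SW_D]]|[R [R_rank cR]]]; last first.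
  exists (path_of m n R sigma).
  by split; [exact: dyck_path_of|exact: SW_of_path_of].
(* The rank set of the path itself is compatible: its letters record the steps, so each shift leads
   to the next point. *)
exists (rank_set D); split.
  by split; [exact: card_rank_set|exact: dyck_rank_set_ge0|exact: rank_set0].
apply/(compatibleE _ sigma_SW) => k lt_k; rewrite -SW_D.
have lt_k' : (k < size (increasing (rank_set D)))%N.
  by rewrite size_increasing card_rank_set.
rewrite (nth_map 0) //; set r := nth _ _ _.
rewrite (_ : (_ == South) = (r \in south_ranks D)); last by case: ifP.
by apply: rank_set_shift => //; rewrite -mem_increasing /r mem_nth.
Qed.
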